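(* Let $X$ be a compact Hausdorff space, and let $G$ be a countable group of homeomorphisms of $X$. Assume that the following conditions are satisfied: (i) $G\curvearrowright X$ is an extreme boundary action; (ii) there is a basis for the topology of $X$ consisting of open sets $U\subset X$ such that the rigid stabilizer $G_U$ admits no non-trivial finite or abelian quotients; (iii) the point stabilizers for the action $G\curvearrowright X$ are maximal subgroups of $G$. Then the only uniformly recurrent subgroups of $G$ are $1$, $G$ and $\mathcal{S}_G(X)$.
   Context: For $U\subset X$, the rigid stabilizer $G_U$ is the subgroup of $G$ of elements fixing $X\setminus U$ pointwise. A subset $Y\subset X$ is compressible if there exists $x\in X$ such that for every open $U\subset X$ containing $x$ there is $g\in G$ with $g(Y)\subset U$. The action is extremely proximal if every closed $C\subset X$ with $C\neq X$ is compressible; it is minimal if every orbit is dense. An extreme boundary action is an action on a compact space that is minimal and extremely proximal. $\mathrm{Sub}(G)$ is the space of subgroups of $G$ with the topology induced from $\{0,1\}^G$, on which $G$ acts by conjugation. A uniformly recurrent subgroup (URS) of $G$ is a (non-empty) closed minimal $G$-invariant subset of $\mathrm{Sub}(G)$. For a normal subgroup $N$ of $G$, the URS $\{N\}$ is denoted $N$; thus $1$ and $G$ denote $\{\{1\}\}$ and $\{G\}$. For a minimal action of $G$ on a compact Hausdorff space $X$, let $X_0\subset X$ be the set of continuity points of the map $\mathrm{Stab}\colon X\to\mathrm{Sub}(G)$, $x\mapsto G_x$ (the stabilizer of $x$). The stabilizer URS $\mathcal{S}_G(X)$ is the closure of $\{G_x : x\in X_0\}$ in $\mathrm{Sub}(G)$;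 it is a URS, and it is the unique URS contained in the closure of $\{G_x : x\in X\}$. *)

(* Defs.v *)
From HB Require Import structures.
From mathcomp Require Import all_boot monoid.
From mathcomp Require Import all_classical topology.

Set Implicit Arguments.
Unset Strict Implicit.
Unset Printing Implicit Defensive.

Local Open Scope classical_set_scope.
Local Open Scope group_scope.

(* Groups are the possibly infinite [groupType]s of [monoid], not the finite
   groups of [fingroup].  In [monoid], [x ^ y] is [y^-1 * (x * y)]. *)

Section Subgroups.
Variable G : groupType.

(* [{ptws G -> bool}] carries the product of the discrete topologies on [bool],
   and the type associated with a set of points carries the induced topology. *)
Definition subgroup_set : set {ptws G -> bool} :=
  [set H | group_closed (H : {pred G})].

Definition subgroup_of : Type := subgroup_set.

HB.instance Definition _ :=
  Topological.copy subgroup_of (set_type subgroup_set).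

Definition subgroup_pred (H : subgroup_of) : pred G :=
  (set_val H : {ptws G -> bool}).

Canonical subgroup_predType := PredType subgroup_pred.

Definition mk_subgroup (P : {pred G}) (hP : group_closed P) : subgroup_of :=
  SigSub (mem_set (hP : subgroup_set (P : G -> bool))).

Lemma group_closed_subgroup (H : subgroup_of) : group_closed (subgroup_pred H).
Proof. exact: (set_mem (valP H)). Qed.

Lemma trivial_closed : group_closed (pred1 (1 : G)).
Proof.
split=> [|x y]; rewrite !inE // => /eqP -> /eqP ->.
by rewrite divg1.
Qed.

Definition trivial_subgroup : subgroup_of := mk_subgroup trivial_closed.

Lemma full_closed : group_closed (@predT G).
Proof. by []. Qed.

Definition full_subgroup : subgroup_of := mk_subgroup full_closed.

Lemma conj_closed (g : G) (H : subgroup_of) :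
  group_closed [pred k | k ^ g \in H].
Proof.
have [H1 HD] := group_closed_subgroup H.
split=> [|x y]; rewrite !inE ?conj1g // => Hx Hy.
by rewrite conjMg conjVg; apply: HD.
Qed.

(* The left action of [G] on its subgroups: [k \in g H g^-1] iff
   [g^-1 k g \in H]. *)
Definition conj_subgroup (g : G) (H : subgroup_of) : subgroup_of :=
  mk_subgroup (conj_closed g H).

Definition invariant_set (A : set subgroup_of) : Prop :=
  forall (g : G) (H : subgroup_of), A H -> A (conj_subgroup g H).

Definition URS (A : set subgroup_of) : Prop :=
  [/\ A !=set0, closed A, invariant_set A &
      forall B : set subgroup_of, B !=set0 -> closed B -> invariant_set B ->
        B `<=` A -> B = A].

Definition maximal_subgroup (M : subgroup_of) : Prop :=
  M <> full_subgroup /\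
  forall H : subgroup_of, {subset M <= H} -> H = M \/ H = full_subgroup.

Definition normal_in (N H : subgroup_of) : Prop :=
  {subset N <= H} /\ forall n h : G, n \in N -> h \in H -> n ^ h \in N.

Definition left_coset (N : subgroup_of) (g : G) : set G :=
  [set g * n | n in [set n | n \in N]].

(* For [N] normal in [H], the underlying set of [H / N]; its product is
   [gN * hN = (g * h)N]. *)
Definition quotient_set (H N : subgroup_of) : set (set G) :=
  [set left_coset N g | g in [set g | g \in H]].

Definition finite_quotient (H N : subgroup_of) : Prop :=
  finite_set (quotient_set H N).

Definition abelian_quotient (H N : subgroup_of) : Prop :=
  forall g h : G, g \in H -> h \in H ->
    left_coset N (g * h) = left_coset N (h * g).

Definition no_finite_or_abelian_quotient (H : subgroup_of) : Prop :=
  forall N : subgroup_of, normal_in N H ->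
    finite_quotient H N \/ abelian_quotient H N -> N = H.

End Subgroups.

(* Each [homeo_act g] is a homeomorphism, with inverse [homeo_act g^-1]. *)
Record homeo_action (G : groupType) (X : topologicalType) := HomeoAction {
  homeo_act :> G -> X -> X;
  homeo_act1 : forall x, homeo_act 1 x = x;
  homeo_actM : forall g h x, homeo_act (g * h) x = homeo_act g (homeo_act h x);
  homeo_act_continuous : forall g, continuous (homeo_act g)
}.

Section Action.
Variables (G : groupType) (X : topologicalType) (a : homeo_action G X).

Definition faithful_action : Prop :=
  forall g : G, (forall x, a g x = x) -> g = 1.

Definition minimal_action : Prop :=
  forall x : X, dense (range (fun g : G => a g x)).

Definition compressible (Y : set X) : Prop :=
  exists x : X, forall U : set X, open U -> U x ->
    exists g : G, a g @` Y `<=` U.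

Definition extremely_proximal : Prop :=
  forall C : set X, closed C -> C <> [set: X] -> compressible C.

Definition extreme_boundary_action : Prop :=
  [/\ compact [set: X], minimal_action & extremely_proximal].

Lemma fix_divg (g h : G) (x : X) :
  a g x = x -> a h x = x -> a (g / h) x = x.
Proof. by move=> gx hx; rewrite -{1}hx -homeo_actM mulgVK. Qed.

Lemma rist_closed (U : set X) :
  group_closed [pred g : G | `[< forall x, ~ U x -> a g x = x >]].
Proof.
split=> [|g h]; rewrite !inE; first by move=> x _; apply: homeo_act1.
by move=> hg hh x Ux; apply: fix_divg; [apply: hg | apply: hh].
Qed.

Definition rist (U : set X) : subgroup_of G := mk_subgroup (rist_closed U).

Lemma stab_closed (x : X) : group_closed [pred g : G | a g x == x].
Proof.
split=> [|g h]; rewrite !inE; first by rewrite homeo_act1.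
by move=> /eqP gx /eqP hx; rewrite fix_divg.
Qed.

Definition Stab (x : X) : subgroup_of G := mk_subgroup (stab_closed x).

Definition Stab_continuity_points : set X :=
  [set x | {for x, continuous Stab}].

Definition stabilizer_URS : set (subgroup_of G) :=
  closure (Stab @` Stab_continuity_points).

End Action.

(* Main.v *)
Require Import Defs.
From HB Require Import structures.
From mathcomp Require Import all_boot monoid.
From mathcomp Require Import all_classical topology.

(** Write [G_U] for the rigid stabiliser of [U], [G_x] for a point stabiliser,
and call [z] generic if every element of [G_z] fixes a whole neighbourhood of
[z]; the generic points are exactly the continuity points of [Stab], and Baire
category provides some because [G] is countable.

If [G_U] is trivial for some non-empty open [U], compressing the complement of a
neighbourhood of a generic point [z] into [U] shows [G_z = 1]. By maximality [1]
and [G] are then the only subgroups, and everything is clear. So let all [G_U]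
be non-trivial, and let [A] be a URS different from [1].

The heart of the matter is that some [K] in [A] contains [G_W] for a non-empty
open [W] ([URS_contains_rist]).
- Some [K] in [A], point [e] and open [O] containing [e] are such that no limit of
  conjugates of [K] by [G_O] fixes [e] together with the fixed points of [K]
  outside [O]. Otherwise fixed points could be added one after the other, and
  compactness would put the trivial group in [A]
  ([trivial_of_pointwise_limits]). By compactness again, a finite set [P] of
  elements that move [e] meets every conjugate of [K] by [G_O]
  ([confining_family]). Shrink [O] to a basic open [U] displaced by all of [P].
- Colour [y] in [G_U] by some [p] in [P] with [p ^ y] in [K]. If [y] and [k] have
  colour [p], then [p ^ y * (p ^ k)^-1] lies in [K] and acts on [U] as
  [y^-1 * k] ([displaced_quotient]). So the elements of [G_U] that are imitated
  on [U] by elements of [K] form a subgroup of finite index, hence all of [G_U]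
  as [G_U] has no finite quotient ([coset_colouring]); thus [K] meets [G_U] in a
  subgroup normal in [G_U].
- This subgroup is not trivial: four elements [s1 * t1], [s2 * t1], [s2 * t2],
  [s1 * t2] of the same colour give an element of [K] in [G_U]
  ([displaced_square]), and the pigeonhole principle finds such a monochromatic
  square whose element is not [1].
- A double commutator argument turns a non-trivial normal subgroup of [G_U] into
  some [G_W], since [G_W] is perfect ([normal_contains_rist]).

Conjugates of such a [K] by elements that compress the complement of [W] towards
a generic point [z] accumulate at a member of [A] that contains [G_z]
([limit_contains_Stab]). As [G_z] is maximal, [A] contains [G] or [G_z], so [A]
is [G] or the stabiliser URS. The latter is a URS because each of its members
lies between the elements that are trivial near some [x] and [G_x]
([stabilizer_URS_sandwich]), two groups that agree at a generic point. *)

Set Implicit Arguments.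
Unset Strict Implicit.
Unset Printing Implicit Defensive.

Local Open Scope classical_set_scope.
Local Open Scope group_scope.

(** * The compact space of subgroups *)

Section Compactness.
Variable T : topologicalType.

(** Limit arguments all go through this form of compactness: build a proper
filter, take one limit point, and read off each closed property that holds
eventually. *)
Lemma compact_limit (F : set_system T) :
  compact [set: T] -> ProperFilter F ->
  exists t, forall C, closed C -> F C -> C t.
Proof.
move=> Tcpt FF; have [t [_]] := Tcpt F FF filterT.
rewrite clusterE => Ft; exists t => C Ccl FC.
by rewrite (closure_id C).1 //; apply: Ft.
Qed.

End Compactness.

Section SubgroupSpace.
Variable G : groupType.
Implicit Types (H K : subgroup_of G) (A : set (subgroup_of G)).

Lemma subgroup1 K : 1 \in K.
Proof. by have [] := group_closed_subgroup K. Qed.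

Lemma subgroupV K g : g \in K -> g^-1 \in K.
Proof.
have [K1 KD] := group_closed_subgroup K.
by move=> Kg; rewrite -(mul1g g^-1); apply: KD.
Qed.

Lemma subgroupM K g h : g \in K -> h \in K -> g * h \in K.
Proof.
have [K1 KD] := group_closed_subgroup K.
by move=> Kg /subgroupV Kh; rewrite -(invgK h); apply: KD.
Qed.

Lemma eq_subgroup H K : H =i K -> H = K.
Proof. by move=> HK; apply/val_inj/funext => g; apply: HK. Qed.

Lemma in_mk_subgroup (P : pred G) (hP : group_closed P) g :
  (g \in mk_subgroup hP) = P g.
Proof. by []. Qed.

Lemma in_conj_subgroup g K k : (k \in conj_subgroup g K) = (k ^ g \in K).
Proof. by []. Qed.

(** The topology is the one of pointwise convergence of indicator functions, and
[bool] is discrete. *)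
Lemma cvg_subgroupP (F : set_system (subgroup_of G)) H : Filter F ->
  F --> H <-> forall g, F [set K | (g \in K) = (g \in H)].
Proof.
move=> FF; split=> [FH g|FH].
  have cont : continuous (set_val : subgroup_of G -> {ptws G -> bool}).
    exact: initial_continuous.
  have coord : continuous (@proj G (fun=> bool) g : {ptws G -> bool} -> bool).
    exact: proj_continuous.
  have := cvg_comp _ _ (cvg_comp _ _ FH (cont H)) (coord _).
  by move/(_ [set set_val H g]); apply; apply: discrete_set1.
have cvgF : (set_val : subgroup_of G -> {ptws G -> bool}) @ F -->
    (set_val H : {ptws G -> bool}).
  apply/cvg_sup => g B [C [[D oD <-] DH] CB].
  apply: filterS CB _; apply: (@filterS _ F _ _ _ _ (FH g)) => K /= KH.
  by have -> : set_val K g = set_val H g by exact: KH.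
move=> B [C [[D oD <-] DH] CB].
apply: filterS CB _; apply: cvgF; exact: open_nbhs_nbhs.
Qed.

Lemma near_mem H g : nbhs H [set K | (g \in K) = (g \in H)].
Proof. exact: (cvg_subgroupP H _).1. Qed.

Lemma closed_contains g : closed [set K : subgroup_of G | g \in K].
Proof.
by move=> K /(_ _ (near_mem K g)) [H [/= Hg <-]].
Qed.

Lemma closed_avoids g : closed [set K : subgroup_of G | g \notin K].
Proof.
by move=> K /(_ _ (near_mem K g)) [H [/= Hg <-]].
Qed.

(** An ultrafilter converges to the set of the elements that belong to almost
all subgroups, which is again a subgroup. *)
Lemma compact_subgroups : compact [set: subgroup_of G].
Proof.
rewrite compact_ultra => F FU _.
pose P : pred G := fun g => `[< F [set K | g \in K] >].
have hP : group_closed (P : {pred G}).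
  split=> [|g h]; rewrite !inE; first by apply: filterS filterT => K _; exact: subgroup1.
  move=> Fg Fh; apply: filterS2 Fg Fh => K /= Kg Kh.
  exact: subgroupM (subgroupV _).
exists (mk_subgroup hP); split=> //=; apply/cvg_subgroupP => g.
have [FK|nFK] := in_ultra_setVsetC [set K : subgroup_of G | g \in K] FU.
  by apply: filterS (FK) => K /= ->; rewrite in_mk_subgroup; apply/esym/asboolP.
apply: filterS (nFK) => K /= /negP/negPf ->; rewrite in_mk_subgroup.
apply/esym/asboolP => FK.
have FF : ProperFilter F by exact: ultra_proper.
by have [L /= []] := filter_ex (filterI FK nFK).
Qed.

Lemma limit_subgroup (F : set_system (subgroup_of G)) : ProperFilter F ->
  exists K, forall C, closed C -> F C -> C K.
Proof. exact/compact_limit/compact_subgroups. Qed.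

Lemma conj_subgroup_continuous g : continuous (@conj_subgroup G g).
Proof.
move=> K; apply/cvg_subgroupP; first exact: (@fmap_filter _ _ _ (nbhs K)).
by move=> k; exact: near_mem K (k ^ g).
Qed.

Lemma closed_subgroup1 K : closed [set K].
Proof.
have -> : [set K] = \bigcap_g [set H : subgroup_of G | (g \in H) = (g \in K)].
  apply/seteqP; split=> [_ -> //|H HK]; apply: eq_subgroup => g; exact: HK.
apply: closed_bigI => g _; case: (g \in K); first exact: closed_contains.
have -> : [set H : subgroup_of G | (g \in H) = false] = [set H | g \notin H].
  by apply/seteqP; split=> H /= => [->|/negPf].
exact: closed_avoids.
Qed.

Lemma URS_set1 K : (forall g, conj_subgroup g K = K) -> URS [set K].
Proof.
move=> inv; split; [by exists K|exact: closed_subgroup1|by move=> g _ ->|].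
move=> B [H BH] _ _ BK; apply/seteqP; split=> // _ ->.
by rewrite -(BK _ BH).
Qed.

(** Distinct minimal sets are disjoint, the intersection being closed and
invariant. *)
Lemma URS_eq A B : URS A -> URS B -> A `&` B !=set0 -> A = B.
Proof.
move=> [A0 Ac Ai Am] [B0 Bc Bi Bm] AB0.
have cl : closed (A `&` B) by apply: closedI.
have inv : invariant_set (A `&` B) by move=> g H [/Ai ? /Bi ?].
by rewrite -(Am _ AB0 cl inv) -1?{2}(Bm _ AB0 cl inv).
Qed.

Lemma conj_trivial g : conj_subgroup g (trivial_subgroup G) = trivial_subgroup G.
Proof.
apply: eq_subgroup => k; rewrite in_conj_subgroup !in_mk_subgroup /=.
by rewrite conjg_eq1.
Qed.

Lemma conj_full g : conj_subgroup g (full_subgroup G) = full_subgroup G.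
Proof. exact: eq_subgroup. Qed.

End SubgroupSpace.

(** * Subgroups of finite index, seen as colourings *)

(** The hypothesis says that [R] has finite index in [H], with the finitely many
cosets given as colour classes. Elements of [H] whose left multiplication sends
a representative of each class to the same colours differ by an element of the
normal core of [R], which thus has finite index and must be [H]. *)
Lemma coset_colouring (G : groupType) (H R : subgroup_of G) (I : finType)
    (col : G -> I) :
  no_finite_or_abelian_quotient H ->
  {subset R <= H} ->
  (forall y k, y \in H -> k \in H -> col y = col k -> y^-1 * k \in R) ->
  R = H.
Proof.
move=> Hq RH colR.
pose core : pred G :=
  fun v => (v \in H) && `[< forall h, h \in H -> v ^ h \in R >].
have core1 : core 1.
  by rewrite /core subgroup1; apply/asboolP => h _; rewrite conj1g subgroup1.
have coreD v w : core v -> core w -> core (v / w).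
  move=> /andP[Hv /asboolP cv] /andP[Hw /asboolP cw].
  rewrite /core subgroupM ?subgroupV//; apply/asboolP => h Hh.
  by rewrite conjMg conjVg subgroupM ?subgroupV ?cv ?cw.
pose N := mk_subgroup (conj core1 coreD : group_closed (core : {pred G})).
have inN v : (v \in N) = core v by [].
have NH : {subset N <= H} by move=> v; rewrite inN => /andP[].
suff NE : N = H.
  apply: eq_subgroup => v; apply/idP/idP; first exact: RH.
  rewrite -NE inN => /andP[_ /asboolP vR].
  by rewrite -(conjg1 v); apply: vR; exact: subgroup1.
apply: Hq.
  split=> // n h; rewrite !inN => /andP[Hn /asboolP cn] Hh.
  rewrite /core conjgE !subgroupM ?subgroupV//; apply/asboolP => k Hk.
  by rewrite -conjgE -conjgM cn ?subgroupM.
left.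
(* A representative of each colour class. *)
pose r i := xget 1 [set h | h \in H /\ col h = i].
have rP h : h \in H -> r (col h) \in H /\ col (r (col h)) = col h.
  by move=> Hh; rewrite /r; case: xgetP => [x _ //|/(_ h) []].
pose sig g : {ffun I -> I} := [ffun i => col (g * r i)].
have sigN g g' : g \in H -> g' \in H -> sig g = sig g' -> g^-1 * g' \in N.
  move=> Hg Hg' /ffunP sgg'; rewrite inN /core subgroupM ?subgroupV//.
  apply/asboolP => h Hh; have [Hr rh] := rP h Hh.
  have h1 := colR _ _ Hr Hh rh; have h2 := colR _ _ Hh Hr (esym rh).
  have := sgg' (col h); rewrite !ffunE => /colR h3.
  have := subgroupM (subgroupM h2 (h3 (subgroupM Hg Hr) (subgroupM Hg' Hr))) h1.
  by rewrite conjgE !invgM !mulgA !mulgK.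
have cosetE g g' : g^-1 * g' \in N -> left_coset N g' `<=` left_coset N g.
  move=> Ngg' _ [n Nn <-]; exists (g^-1 * g' * n); first exact: subgroupM.
  by rewrite !mulgA mulgV mul1g.
pose pick f := left_coset N (xget 1 [set g | g \in H /\ sig g = f]).
apply: (@sub_finite_set _ _ (pick @` [set: {ffun I -> I}])); last first.
  exact/finite_image/finite_finset.
move=> _ [g Hg <-]; exists (sig g) => //; rewrite /pick.
case: xgetP => [g' _ [Hg' sg']|/(_ g) []//].
by apply/seteqP; split; apply: cosetE; apply: sigN.
Qed.

(** * Rigid stabilisers *)

Section Action.
Variables (G : groupType) (X : topologicalType) (a : homeo_action G X).
Implicit Types (g h k : G) (x y : X) (U V W O : set X) (K : subgroup_of G).

Lemma actK g x : a g^-1 (a g x) = x.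
Proof. by rewrite -homeo_actM mulVg homeo_act1. Qed.

Lemma actKV g x : a g (a g^-1 x) = x.
Proof. by rewrite -homeo_actM mulgV homeo_act1. Qed.

Lemma act_inj g : injective (a g).
Proof. exact: can_inj (actK g). Qed.

Lemma act_fixV g x : a g x = x -> a g^-1 x = x.
Proof. by move=> gx; apply: (@act_inj g); rewrite actKV. Qed.

Lemma open_act g U : open U -> open (a g @^-1` U).
Proof. by move=> oU; apply: open_comp => // x _; exact: homeo_act_continuous. Qed.

Lemma ristP U g : reflect (forall x, ~ U x -> a g x = x) (g \in rist a U).
Proof. exact: asboolP. Qed.

Lemma StabP x g : reflect (a g x = x) (g \in Stab a x).
Proof. exact: eqP. Qed.

Lemma rist_sub U V : U `<=` V -> {subset rist a U <= rist a V}.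
Proof. by move=> UV g /ristP gU; apply/ristP => x Vx; apply: gU => /UV. Qed.

Lemma rist_stable U g x : g \in rist a U -> U x -> U (a g x).
Proof.
move=> /ristP gU Ux; apply: contrapT => nU.
by apply: (nU); rewrite (act_inj (gU _ nU)).
Qed.

(** [V] contains the image of [U] under [h]; in particular compressing [U] into [V]
conjugates [G_U] into [G_V]. *)
Lemma rist_conj U V g h : (forall x, U x -> V (a h x)) ->
  g \in rist a U -> g ^ h^-1 \in rist a V.
Proof.
move=> UV /ristP gU; apply/ristP => x nV.
rewrite conjgE invgK !homeo_actM gU ?actKV// => /UV.
by rewrite actKV.
Qed.

Lemma rist_move U g : g \in rist a U -> forall x, a g x <> x -> U x.
Proof. by move=> /ristP gU x gx; apply: contrapT => /gU. Qed.

Hypothesis a_faithful : faithful_action a.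

Lemma act_eq g h : (forall x, a g x = a h x) -> g = h.
Proof.
move=> gh; apply: (mulIg h^-1); rewrite mulgV; apply: a_faithful => x.
by rewrite homeo_actM gh actKV.
Qed.

Lemma rist_commute U V g h : (forall x, U x -> V x -> False) ->
  g \in rist a U -> h \in rist a V -> g * h = h * g.
Proof.
move=> UV gU hV; apply: act_eq => x; rewrite !homeo_actM.
have gP := elimT (ristP U g) gU; have hP := elimT (ristP V h) hV.
have [Ux|nUx] := pselect (U x).
  by rewrite (hP x) ?(hP (a g x))//; apply: UV => //; exact: rist_stable.
rewrite (gP x nUx); have [Vx|nVx] := pselect (V x); last by rewrite (hP x nVx) gP.
by rewrite gP// => /UV; apply; exact: rist_stable hV Vx.
Qed.

Lemma exists_moved g : g != 1 -> exists x, a g x <> x.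
Proof.
move=> /eqP g1; apply: contrapT => /forallNP H; apply: g1; apply: a_faithful.
by move=> x; apply: contrapT; apply: H.
Qed.

Hypothesis X_hausdorff : hausdorff_space X.

Lemma separate x y : x <> y ->
  exists U V, [/\ open U, open V, U x, V y & forall z, U z -> V z -> False].
Proof.
move=> /eqP xy; have := X_hausdorff; rewrite open_hausdorff => /(_ _ _ xy).
move=> [[U V] /= [/set_mem Ux /set_mem Vy] [oU oV /eqP UV0]].
exists U, V; split=> // z Uz Vz; have : (U `&` V) z by [].
by rewrite UV0.
Qed.

Lemma displaced_nbhs O g x : open O -> O x -> a g x <> x ->
  exists W, [/\ open W, W `<=` O, W x & forall y, W y -> ~ W (a g y)].
Proof.
move=> oO Ox gx; have [U [V [oU oV Ugx Vx UV]]] := separate gx.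
exists (O `&` (V `&` a g @^-1` U)); split=> //.
- by apply: openI => //; apply: openI => //; exact: open_act.
- by move=> y [_ [_ Ugy]] [_ [Vgy _]]; exact: UV Ugy Vgy.
Qed.

(** Fixing a point passes to limits: it forbids membership of each element that
moves the point. *)
Lemma closed_fixed_by x : closed [set K : subgroup_of G | {subset K <= Stab a x}].
Proof.
have -> : [set K : subgroup_of G | {subset K <= Stab a x}] =
    \bigcap_(g in [set g | g \notin Stab a x]) [set K : subgroup_of G | g \notin K].
  apply/seteqP; split=> [K Kx g/= gx|K Kx g].
    by apply: contra gx; apply: Kx.
  by apply: contraTT => gx; exact: Kx.
by apply: closed_bigI => g _; exact: closed_avoids.
Qed.

Hypothesis rist_neq1 : forall U, open U -> U !=set0 ->
  exists2 g, g \in rist a U & g != 1.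

(** Inside the current [W], some element of [G_W] displaces a smaller open set,
which adds one more translate. *)
Lemma disjoint_translates n O : open O -> O !=set0 ->
  exists (s : nat -> G) W, [/\ open W, W !=set0, W `<=` O,
    forall i, s i \in rist a O &
    forall i j x y, (i < n)%N -> (j < n)%N -> i <> j -> W x -> W y ->
      a (s i) x <> a (s j) y].
Proof.
move=> oO O0; elim: n => [|n [s [W [oW W0 WO sO sW]]]].
  by exists (fun=> 1), O; split=> // i; exact: subgroup1.
have [g gW /exists_moved [x gx]] := rist_neq1 oW W0.
have Wx := rist_move gW gx.
have [V [oV VW Vx gV]] := displaced_nbhs oW Wx gx.
pose s' i := if i == n then s 0%N * g else s i.
exists s', V; split=> //; first by exists x.
- exact: subset_trans WO.
- move=> i; rewrite /s'; case: ifP => _; rewrite ?subgroupM//.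
  exact: rist_sub gW.
- have new i y z : (i < n)%N -> V y -> V z -> a (s i) y <> a (s 0%N * g) z.
    rewrite homeo_actM => lti Vy Vz; have [->|i0] := eqVneq i 0%N.
      by move/act_inj => yz; apply: (gV z) => //; rewrite -yz.
    apply: sW => //; [exact: leq_ltn_trans (leq0n i) lti | exact/eqP
      | exact: VW | exact: rist_stable gW (VW _ Vz)].
  move=> i j y z; rewrite !ltnS /s' (leq_eqVlt i) (leq_eqVlt j).
  have [->|_] /= := eqVneq i n; have [->|_] //= := eqVneq j n.
  + by move=> _ ltj _ Vy Vz /esym; exact: new.
  + by move=> lti _ _; exact: new.
  + by move=> lti ltj ij Vy Vz; apply: sW => //; exact: VW.
Qed.

End Action.

(** * From displacing conjugates to a rigid stabiliser *)

Section Confined.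
Variables (G : groupType) (X : topologicalType) (a : homeo_action G X).
Hypotheses (a_faithful : faithful_action a) (X_hausdorff : hausdorff_space X).
Hypothesis rist_neq1 : forall U, open U -> U !=set0 ->
  exists2 g, g \in rist a U & g != 1.
Variable B : set (set X).
Hypothesis B_basis : basis B.
Hypothesis B_quot :
  forall U, B U -> no_finite_or_abelian_quotient (rist a U).
Implicit Types (g h k : G) (x y : X) (U V W O : set X) (K : subgroup_of G).

Lemma B_open U : B U -> open U.
Proof. by case: B_basis => Bo _; exact: Bo. Qed.

Lemma B_nbhs O x : open O -> O x -> exists W, [/\ B W, W x & W `<=` O].
Proof.
move=> oO Ox; have [_ /(_ x) /(_ O)] := B_basis.
by case; [exact: open_nbhs_nbhs|move=> W [BW Wx] WO; exists W].
Qed.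

Lemma rist_infinite U : B U -> U !=set0 -> infinite_set [set g | g \in rist a U].
Proof.
move=> BU U0 fin; have [g gU] := rist_neq1 (B_open BU) U0.
suff E : trivial_subgroup G = rist a U.
  by move: gU; rewrite -E in_mk_subgroup /= => ->.
apply: (B_quot BU); last by left; exact: finite_image.
split=> [n|n h]; first by rewrite in_mk_subgroup => /eqP ->; exact: subgroup1.
by rewrite !in_mk_subgroup /= => /eqP -> _; rewrite conj1g.
Qed.

(** [G_U] is perfect, so it is enough to catch its commutators. *)
Lemma derived_rist_sub K U : B U ->
  (forall g h, g \in rist a U -> h \in rist a U -> [~ g, h] \in K) ->
  {subset rist a U <= K}.
Proof.
move=> BU comK.
pose D : pred G := fun g => (g \in rist a U) && (g \in K).
have D1 : D 1 by rewrite /D !subgroup1.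
have DD g h : D g -> D h -> D (g / h).
  by move=> /andP[? ?] /andP[? ?]; rewrite /D !subgroupM ?subgroupV.
pose N := mk_subgroup (conj D1 DD : group_closed (D : {pred G})).
have inN g : (g \in N) = D g by [].
suff E : N = rist a U by move=> g; rewrite -{1}E inN => /andP[].
have comN g h : g \in rist a U -> h \in rist a U -> [~ g, h] \in N.
  move=> gU hU; rewrite inN /D comK// commgEl.
  by rewrite subgroupM ?subgroupV// conjgE !subgroupM ?subgroupV.
apply: (B_quot BU).
  split=> [g|n h nN hU]; first by rewrite inN => /andP[].
  have nU : n \in rist a U by move: nN; rewrite inN => /andP[].
  by rewrite -(mulVKg n (n ^ h)) -commgEl subgroupM ?comN.
right=> g h gU hU.
have sub g' h' : g' \in rist a U -> h' \in rist a U ->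
    left_coset N (g' * h') `<=` left_coset N (h' * g').
  move=> gU' hU' _ [n nN <-]; exists ([~ g', h'] * n).
    exact: subgroupM (comN _ _ gU' hU') nN.
  by rewrite commgEl conjgE !mulgA mulgK mulgV mul1g.
by apply/seteqP; split; exact: sub.
Qed.

(** Let [n] displace [W]. For [g] and [h] in [G_W], the element [g ^ n] commutes with
[h], so that [c = g^-1 * g ^ n], which lies in [K], satisfies
[[~ c^-1, h] = [~ g, h]]. Thus [K] contains all commutators of [G_W]. *)
Lemma normal_contains_rist K U :
  B U -> (forall n h, n \in rist a U -> n \in K -> h \in rist a U ->
    n ^ h \in K) ->
  (exists n, [/\ n \in rist a U, n \in K & n != 1]) ->
  exists W, [/\ open W, W !=set0 & {subset rist a W <= K}].
Proof.
move=> BU KU [n [nU nK /(exists_moved a_faithful) [x nx]]].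
have Ux := rist_move nU nx.
have [O [oO OU Ox nO]] := displaced_nbhs X_hausdorff (B_open BU) Ux nx.
have [W [BW Wx WO]] := B_nbhs oO Ox.
exists W; split; [exact: B_open|by exists x|apply: derived_rist_sub => // g h gW hW].
have WU : {subset rist a W <= rist a U} by apply: rist_sub => y /WO /OU.
pose d := g ^ n.
have dW : d \in rist a (a n @^-1` W).
  have := rist_conj (V := a n @^-1` W) (h := n^-1) _ gW.
  by rewrite invgK; apply=> y Wy /=; rewrite actKV.
have dh : d * h = h * d.
  apply: (rist_commute a_faithful _ dW hW) => y /= Wny Wy.
  by apply: (nO y); exact: WO.
have gU := WU _ gW; have hU := WU _ hW.
pose c := g^-1 * d.
have cU : c \in rist a U by rewrite /c /d conjgE !subgroupM ?subgroupV.
have cK : c \in K.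
  have -> : c = (n^-1) ^ g * n by rewrite /c /d !conjgE !mulgA.
  by rewrite subgroupM// KU ?subgroupV.
clearbody d.
have -> : [~ g, h] = c * (c^-1) ^ h.
  rewrite commgEl !conjgE /c invgM invgK !mulgA; congr (_ * _ * _).
  have dhV : d * h^-1 = h^-1 * d by apply: (mulIg h); rewrite mulgVK -mulgA dh mulKg.
  by rewrite -(mulgA _ d) dhV !mulgA mulgK.
by rewrite subgroupM// KU ?subgroupV.
Qed.

Lemma finite_colour_repeat (I : finType) (S : set G) (f : G -> I) :
  infinite_set S -> exists t t', [/\ S t, S t', t != t' & f t = f t'].
Proof.
move=> Sinf; apply: contrapT => H; apply: Sinf.
have finj : {in S &, injective f}.
  move=> t t' /set_mem St /set_mem St' ftt'; apply: contrapT => /eqP tt'.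
  by apply: H; exists t, t'.
rewrite -(eq_finite_set (inj_card_eq finj)).
by apply: (@sub_finite_set _ _ setT) => //; exact: finite_finset.
Qed.

(** The elements [p i] all displace [U] and form a finite family that meets every
conjugate of [K] by [G_U]. *)
Section Displacing.
Variables (K : subgroup_of G) (U : set X) (I : finType) (p : I -> G).
Hypothesis pU : forall i x, U x -> ~ U (a (p i) x).

(** The factor of this element that comes from [y * k^-1] is conjugated away from
[U] by [p i]. *)
Lemma displaced_quotient i (y k : G) x : y \in rist a U -> k \in rist a U -> U x ->
  a (p i ^ y * (p i ^ k)^-1) x = a (y^-1 * k) x.
Proof.
move=> yU kU Ux; rewrite !conjgE !invgM !invgK -!mulgA !homeo_actM.
congr (a _ _); have Ukx : U (a k x) by exact: rist_stable.
have qU : ~ U (a (p i)^-1 (a k x)).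
  by move=> /(@pU i); rewrite actKV.
have fixq g : g \in rist a U ->
    a g (a (p i)^-1 (a k x)) = a (p i)^-1 (a k x).
  by move=> /ristP; apply.
by rewrite (fixq k^-1) ?subgroupV// (fixq y)// actKV.
Qed.

(** The square is chosen so that the two displaced factors are inverse to each
other, as [s1 * t1 * (s2 * t1)^-1] and [s2 * t2 * (s1 * t2)^-1] are; they commute
with [G_U] and cancel. *)
Lemma displaced_square i s1 s2 t1 t2 :
  s1 \in rist a U -> s2 \in rist a U -> t1 \in rist a U -> t2 \in rist a U ->
  p i ^ (s1 * t1) \in K -> p i ^ (s2 * t1) \in K ->
  p i ^ (s2 * t2) \in K -> p i ^ (s1 * t2) \in K ->
  (s1 * t1)^-1 * (s2 * t1) * ((s2 * t2)^-1 * (s1 * t2)) \in K.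
Proof.
move=> s1U s2U t1U t2U K1 K2 K3 K4.
set q := p i in K1 K2 K3 K4.
pose c := (s1 * s2^-1) ^ q^-1.
have cV : c \in rist a (a q^-1 @^-1` U).
  apply: (rist_conj (U := U)); first by move=> x Ux /=; rewrite actK.
  exact: subgroupM (subgroupV _).
have ch h : h \in rist a U -> c * h = h * c.
  move=> hU; apply: (rist_commute a_faithful _ cV hU) => x /= Uqx Ux.
  by have := @pU i _ Uqx; rewrite actKV.
have E1 : q ^ (s1 * t1) * (q ^ (s2 * t1))^-1 = (s1 * t1)^-1 * c * (s2 * t1).
  by rewrite /c !conjgE !invgM !invgK !mulgA !mulgK.
have E2 : q ^ (s2 * t2) * (q ^ (s1 * t2))^-1 = (s2 * t2)^-1 * c^-1 * (s1 * t2).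
  by rewrite /c !conjgE !invgM !invgK !mulgA !mulgK.
have := subgroupM (subgroupM K1 (subgroupV K2)) (subgroupM K3 (subgroupV K4)); rewrite E1 E2.
have -> // : (s1 * t1)^-1 * c * (s2 * t1) * ((s2 * t2)^-1 * c^-1 * (s1 * t2)) =
   (s1 * t1)^-1 * (s2 * t1) * ((s2 * t2)^-1 * (s1 * t2)).
clearbody c; rewrite -(mulgA _ c) ch ?subgroupM// -!mulgA; congr (_ * (_ * (_ * _))).
by rewrite (mulgA c) ch ?subgroupV ?subgroupM// -!mulgA mulVKg.
Qed.

Hypothesis BU : B U.
Hypothesis U0 : U !=set0.
Hypothesis Kp : forall y : G, y \in rist a U -> exists i, p i ^ y \in K.

Lemma displaced_cover_contains_rist :
  exists W, [/\ open W, W !=set0 & {subset rist a W <= K}].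
Proof.
have [i0 _] := Kp (subgroup1 _).
pose col (y : G) := odflt i0 [pick i | p i ^ y \in K].
have colP (y : G) : y \in rist a U -> p (col y) ^ y \in K.
  by move=> /Kp [i iK]; rewrite /col; case: pickP => //= /(_ i); rewrite iK.
apply: (normal_contains_rist BU).
  (* The elements of [G_U] that are imitated on [U] by elements of [K]. *)
  pose R0 : pred G := fun v => (v \in rist a U) &&
    `[< exists2 w, w \in K & forall x, U x -> a w x = a v x >].
  have R1 : R0 1 by rewrite /R0 subgroup1; apply/asboolP; exists 1; rewrite ?subgroup1.
  have RD v v' : R0 v -> R0 v' -> R0 (v / v').
    move=> /andP[vU /asboolP[w wK wv]] /andP[vU' /asboolP[w' wK' wv']].
    rewrite /R0 subgroupM ?subgroupV//; apply/asboolP; exists (w * w'^-1).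
      by rewrite subgroupM ?subgroupV.
    move=> x Ux; rewrite !homeo_actM.
    have Ux' : U (a v'^-1 x) by apply: rist_stable => //; exact: subgroupV.
    by rewrite -{1}[x](actKV a v') -wv'// actK wv.
  pose R := mk_subgroup (conj R1 RD : group_closed (R0 : {pred G})).
  have inR v : (v \in R) = R0 v by [].
  have RU : R = rist a U.
    apply: (coset_colouring (col := col) (B_quot BU)) => [v|y k yU kU ck].
      by rewrite inR => /andP[].
    rewrite inR /R0 subgroupM ?subgroupV//; apply/asboolP.
    exists (p (col y) ^ y * (p (col y) ^ k)^-1).
      by rewrite subgroupM ?subgroupV ?colP// ck colP.
    by move=> x Ux; exact: displaced_quotient.
  move=> n h nU nK; rewrite -RU inR => /andP[hU /asboolP[w wK wh]].
  suff -> : n ^ h = n ^ w by rewrite conjgE !subgroupM ?subgroupV.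
  have hxU x : U x -> a w^-1 x = a h^-1 x.
    move=> Ux; have Uhx : U (a h^-1 x) by apply: rist_stable => //; exact: subgroupV.
    by rewrite -{1}[x](actKV a h) -wh// actK.
  have sub g x : (forall x, U x -> a g^-1 x = a h^-1 x) ->
      (forall x, U x -> a g x = a h x) -> a (n ^ g) x = a (n ^ h) x.
    move=> gh' gh; rewrite !conjgE !homeo_actM; have [Ux|nUx] := pselect (U x).
      rewrite gh// gh'//; apply: rist_stable => //; exact: rist_stable.
    have fixn y : ~ U y -> a n y = y by move: nU => /ristP; exact.
    have -> : a h x = x by move: hU => /ristP; exact.
    rewrite (fixn x nUx) [RHS](_ : _ = x); last first.
      by move: (subgroupV hU) => /ristP; exact.
    rewrite fixn ?actK// => Ugx; apply: nUx.
    by rewrite -[x](actK a g) gh'//; apply: rist_stable => //; exact: subgroupV.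
  by apply: (act_eq a_faithful) => x; exact/esym/sub.
have [s [W0 [oW0 [w0 W0w0] W0U sU sW0]]] :=
  disjoint_translates a_faithful X_hausdorff rist_neq1 #|I|.+1 (B_open BU) U0.
have [W [BW Ww0 WW0]] := B_nbhs oW0 W0w0.
have WU : {subset rist a W <= rist a U} by apply: rist_sub => x /WW0 /W0U.
(* Two elements [t] and [t'] colour all rows alike; with more rows than colours,
   two of the rows agree as well. *)
pose f t : {ffun 'I_#|I|.+1 -> I} := [ffun i : 'I_#|I|.+1 => col (s i * t)].
have Winf : infinite_set [set g | g \in rist a W].
  by apply: rist_infinite => //; exists w0.
have [t [t' [tW tW' tt' ftt']]] := finite_colour_repeat f Winf.
have [i [j ij fij]] : exists i, exists2 j, i != j & f t i = f t j.
  apply: contrapT => H.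
  have inj : injective (f t).
    move=> i j fij; apply/eqP; apply: contrapT => /negP ij; apply: H.
    by exists i, j.
  by have := leq_card _ inj; rewrite card_ord ltnn.
have fij' : f t' i = f t' j by rewrite -ftt'.
move: fij fij' (congr1 (fun h : {ffun _} => h i) ftt') => /=; rewrite !ffunE.
set c := col (s i * t) => cj c'j c'i.
have tU := WU _ tW; have tU' := WU _ tW'.
have zK : (s i * t)^-1 * (s j * t) * ((s j * t')^-1 * (s i * t')) \in K.
  apply: (@displaced_square c) => //.
  - by rewrite colP// subgroupM.
  - by rewrite cj colP// subgroupM.
  - by rewrite c'i c'j colP// subgroupM.
  - by rewrite c'i colP// subgroupM.
eexists; split; [|exact: zK|]; first by rewrite !subgroupM ?subgroupV ?subgroupM.
(* The square gives [1] only if [t' * t^-1], a non-trivial element of [G_W],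
   commutes with [(s i)^-1 * s j], which displaces [W]. *)
apply/eqP => z1.
pose u := (s i)^-1 * s j; pose v := t' * t^-1.
have uv : v * u = u * v.
  have {}z1 : t^-1 * u * t = t'^-1 * u * t'.
    apply: (mulIg ((s j * t')^-1 * (s i * t'))).
    rewrite /u; move: z1; rewrite !invgM !mulgA => ->.
    by rewrite !mulgK mulgVK mulVg.
  have -> : v * u = t' * (t^-1 * u * t) * t^-1 by rewrite /v !mulgA mulgK.
  by rewrite z1 /v !mulgA mulgV mul1g.
have vW : v \in rist a W by rewrite subgroupM ?subgroupV.
have v1 : v != 1.
  by apply: contra tt' => /eqP vE; rewrite eq_sym -(mulgVK t t') -/v vE mul1g.
have [x vx] := exists_moved a_faithful v1.
have Wx := rist_move vW vx.
apply: vx; apply: (@act_inj _ _ a u).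
  rewrite -homeo_actM -uv homeo_actM.
move: vW => /ristP; apply => /WW0 Wux.
apply: (sW0 i j (a u x) x (ltn_ord i) (ltn_ord j)) => //.
- by move/val_inj => ijE; rewrite ijE eqxx in ij.
- exact: WW0.
- by rewrite -homeo_actM /u mulVKg.
Qed.

End Displacing.
End Confined.

(** * Confinement and limits *)

Section Limits.
Variables (G : groupType) (X : topologicalType) (a : homeo_action G X).
Hypotheses (a_faithful : faithful_action a) (X_hausdorff : hausdorff_space X).
Implicit Types (g h k : G) (x y z : X) (U V W O : set X) (K : subgroup_of G).

Lemma all_fixed_trivial K :
  (forall x, {subset K <= Stab a x}) -> K = trivial_subgroup G.
Proof.
move=> Kfix; apply: eq_subgroup => g; rewrite [RHS]in_mk_subgroup /=.
apply/idP/eqP => [gK|->]; last exact: subgroup1.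
by apply: a_faithful => x; apply/StabP; exact: Kfix.
Qed.

Lemma seq_open_avoid (s : seq X) e : e \notin s ->
  exists O, [/\ open O, O e & forall x, x \in s -> ~ O x].
Proof.
elim: s => [|x s IH]; first by exists setT; split=> //; exact: openT.
rewrite inE negb_or => /andP[/eqP ex /IH [O [oO Oe Os]]].
have [V [V' [oV oV' Ve V'x VV']]] := separate X_hausdorff ex.
exists (O `&` V); split; [exact: openI|by []|].
move=> y; rewrite inE => /orP[/eqP -> [_ Vx]|/Os Oy []//].
exact: VV' Vx V'x.
Qed.

(** The third hypothesis allows adding one fixed point [e] while keeping those
outside a small neighbourhood of [e]. Finitely many steps give members of [A]
that fix any given finite set, and compactness gives one that fixes
everything. *)
Lemma trivial_of_pointwise_limits (A : set (subgroup_of G)) :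
  A !=set0 -> closed A ->
  (forall K e O, A K -> open O -> O e -> exists K', [/\ A K',
    {subset K' <= Stab a e} &
    forall x, ~ O x -> {subset K <= Stab a x} -> {subset K' <= Stab a x}]) ->
  A (trivial_subgroup G).
Proof.
move=> A0 Acl step.
pose S (s : seq X) := [set K | A K /\ forall x, x \in s -> {subset K <= Stab a x}].
have S0 s : S s !=set0.
  elim: s => [|e s [K [AK Ks]]]; first by have [K AK] := A0; exists K.
  have [es|nes] := boolP (e \in s).
    by exists K; split=> // x; rewrite inE => /orP[/eqP ->|]; exact: Ks.
  have [O [oO Oe Os]] := seq_open_avoid nes.
  have [K' [AK' K'e K'O]] := step K e O AK oO Oe.
  exists K'; split=> // x; rewrite inE => /orP[/eqP -> //|xs].
  by apply: K'O (Ks _ xs); exact: Os.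
have FF : ProperFilter (filter_from [set: seq X] S).
  apply: filter_from_proper => //; apply: filter_fromT_filter; first by exists [::].
  move=> s t; exists (s ++ t) => K [AK Kst].
  by split; split=> // x xst; apply: Kst; rewrite mem_cat xst ?orbT.
have [K KF] := limit_subgroup FF.
have AK : A K by apply: KF => //; exists [::] => // H [].
rewrite -(@all_fixed_trivial K)// => x.
apply: (KF _ (@closed_fixed_by _ _ a x)); exists [:: x] => // H [_]; apply.
by rewrite inE.
Qed.

(** If no finite [P] worked, conjugates of [K] by [G_O] that avoid larger and larger
finite sets of elements moving [e] would accumulate at a group fixing [e]. Points
outside [O] that [K] fixes remain fixed, because [G_O] does not move them. *)
Lemma confining_family (A : set (subgroup_of G)) K e O :
  closed A -> invariant_set A -> A K ->
  (forall K', A K' -> {subset K' <= Stab a e} ->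
     ~ forall x, ~ O x -> {subset K <= Stab a x} -> {subset K' <= Stab a x}) ->
  exists P : seq G, (forall p, p \in P -> a p e <> e) /\
    forall y : G, y \in rist a O -> exists2 p, p \in P & p ^ y \in K.
Proof.
move=> Acl Ainv AK noK'; apply: contrapT => H.
pose D := [set P : seq G | forall p, p \in P -> a p e <> e].
pose S (P : seq G) := [set conj_subgroup y K | y in
  [set y : G | y \in rist a O /\ forall p, p \in P -> p ^ y \notin K]].
have S0 P : D P -> S P !=set0.
  move=> DP; apply: contrapT => SP; apply: H; exists P; split=> // y yO.
  apply: contrapT => nP; apply: SP; exists (conj_subgroup y K), y => //; split=> //.
  by move=> p pP; apply/negP => pyK; apply: nP; exists p.
have FF : ProperFilter (filter_from D S).
  apply: filter_from_proper => //; apply: filter_from_filter; first by exists [::].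
  move=> P Q DP DQ; exists (P ++ Q).
    by move=> p; rewrite mem_cat => /orP[/DP|/DQ].
  move=> _ [y [yO Py] <-].
  by split; exists y => //; split=> // p pP; apply: Py; rewrite mem_cat pP ?orbT.
have [K' K'F] := limit_subgroup FF.
apply: (noK' K').
- by apply: K'F => //; exists [::] => // _ [y _ <-]; exact: Ainv.
- move=> p pK'; apply/StabP; apply: contrapT => pe.
  have : p \notin K'; last by rewrite pK'.
  apply: (K'F _ (@closed_avoids _ p)); exists [:: p].
    by move=> q; rewrite inE => /eqP ->.
  by move=> _ [y [_ Py] <-]; rewrite /= in_conj_subgroup Py// inE.
- move=> x nOx Kx; apply: (K'F _ (@closed_fixed_by _ _ a x)); exists [::] => //.
  move=> _ [y [/ristP yO _] <-] k; rewrite in_conj_subgroup => /Kx /StabP.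
  rewrite conjgE !homeo_actM yO// => kx; apply/StabP.
  by apply: (act_inj (a := a) (g := y^-1)); rewrite kx (act_fixV (yO _ nOx)).
Qed.

Lemma displace_point_nbhs (P : seq G) e O : open O -> O e ->
  (forall p, p \in P -> a p e <> e) ->
  exists W, [/\ open W, W `<=` O, W e &
    forall p, p \in P -> forall y, W y -> ~ W (a p y)].
Proof.
move=> oO Oe; elim: P => [|p P IH] Pe; first by exists O; split=> // p; rewrite in_nil.
have [|W [oW WO We WP]] := IH; first by move=> q qP; apply: Pe; rewrite inE qP orbT.
have pe : a p e <> e by apply: Pe; rewrite inE eqxx.
have [V [oV VW Ve Vp]] := displaced_nbhs X_hausdorff oW We pe.
exists V; split=> //; first exact: subset_trans WO.
move=> q; rewrite inE => /orP[/eqP -> //|qP] y /VW Wy /VW.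
exact: WP qP _ Wy.
Qed.

Lemma URS_contains_rist (B : set (set X)) (A : set (subgroup_of G)) :
  (forall U, open U -> U !=set0 -> exists2 g, g \in rist a U & g != 1) ->
  basis B -> (forall U, B U -> no_finite_or_abelian_quotient (rist a U)) ->
  A !=set0 -> closed A -> invariant_set A -> ~ A (trivial_subgroup G) ->
  exists K W, [/\ A K, open W, W !=set0 & {subset rist a W <= K}].
Proof.
move=> rist_neq1 Bb Bq A0 Acl Ainv A1.
have [K [e [O [AK oO Oe noK']]]] : exists K e O, [/\ A K, open O, O e &
    forall K', A K' -> {subset K' <= Stab a e} ->
    ~ forall x, ~ O x -> {subset K <= Stab a x} -> {subset K' <= Stab a x}].
  apply: contrapT => H; apply: A1; apply: trivial_of_pointwise_limits => //.
  move=> K e O AK oO Oe; apply: contrapT => H'; apply: H; exists K, e, O.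
  by split=> // K' AK' K'e K'O; apply: H'; exists K'.
have [P [Pe PK]] := confining_family Acl Ainv AK noK'.
have [V [oV VO Ve VP]] := displace_point_nbhs oO Oe Pe.
have [U [BU Ue UV]] := B_nbhs Bb oV Ve.
have cover (y : G) : y \in rist a U -> exists i : 'I_(size P), nth 1 P i ^ y \in K.
  move=> yU; have [|p pP pK] := PK y; first by apply: rist_sub yU => x /UV /VO.
  have ip : (index p P < size P)%N by rewrite index_mem.
  by exists (Ordinal ip); rewrite /= nth_index.
have disp (i : 'I_(size P)) x : U x -> ~ U (a (nth 1 P i) x).
  by move=> /UV Vx /UV; apply: VP => //; exact: mem_nth.
have [W [oW W0 WK]] := displaced_cover_contains_rist a_faithful X_hausdorff
  rist_neq1 Bb Bq disp BU (ex_intro _ e Ue) cover.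
by exists K, W.
Qed.

(** An element that moves [z] moves all nearby points, so [Stab] can only be
discontinuous by losing elements of [G_z]. *)
Lemma continuity_pointP z : Stab_continuity_points a z <->
  forall g, a g z = z -> nbhs z [set y | a g y = y].
Proof.
have cvgP := @cvg_subgroupP G (Stab a @ nbhs z) (Stab a z)
    (fmap_filter _ (nbhs_filter z)).
rewrite /Stab_continuity_points /=; split=> [/cvgP cz g gz|zP].
  have : nbhs z [set y | (g \in Stab a y) = (g \in Stab a z)] := cz g.
  apply: filterS => y /=; move/StabP: gz => ->.
  by move=> /StabP.
apply/cvgP => g; have [gz|gz] := pselect (a g z = z).
  suff : nbhs z [set y | (g \in Stab a y) = (g \in Stab a z)] by [].
  by apply: filterS (zP g gz) => y /StabP /= ->; apply/esym/StabP.
have [W [oW _ Wz Wg]] := displaced_nbhs X_hausdorff openT I gz.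
have : nbhs z W by exact: open_nbhs_nbhs.
suff WS : W `<=` [set y | (g \in Stab a y) = (g \in Stab a z)] by exact: filterS.
move=> y Wy /=; move/StabP/negPf: gz => ->.
by apply/negP => /StabP gy; apply: (Wg y) => //; rewrite gy.
Qed.

End Limits.

(** * Extreme boundary actions *)

Section Boundary.
Variables (G : groupType) (X : topologicalType) (a : homeo_action G X).
Hypotheses (a_faithful : faithful_action a) (X_hausdorff : hausdorff_space X).
Hypothesis boundary : extreme_boundary_action a.
Implicit Types (g h k : G) (x y z : X) (U V W O : set X) (K : subgroup_of G).

(** By minimality, the point towards which a closed set is compressible can be
moved into any open set. *)
Lemma compress_to C O : closed C -> C <> setT -> open O -> O !=set0 ->
  exists g, forall x, C x -> O (a g x).
Proof.
have [_ amin aep] := boundary.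
move=> Ccl /aep -/(_ Ccl) [x xP] oO O0.
have [_ [/[swap] [[h _ <-]] Ohx]] := amin x O O0 oO.
have [g gC] := xP _ (open_act a h oO) Ohx.
by exists (h * g) => y Cy; rewrite homeo_actM; apply: gC; exists y.
Qed.

(** Use [g] with [g] mapping the complement of [W] into a small [O] around [z]: the
conjugate of [K] then contains every element that is trivial on [O], and by
genericity each element of [G_z] is of this kind for small [O]. *)
Lemma limit_contains_Stab (A : set (subgroup_of G)) K W z :
  closed A -> invariant_set A -> A K -> open W -> W !=set0 ->
  {subset rist a W <= K} -> Stab_continuity_points a z ->
  exists2 K', A K' & {subset Stab a z <= K'}.
Proof.
move=> Acl Ainv AK oW [w Ww] WK /(continuity_pointP _ X_hausdorff) zP.
pose S O := [set conj_subgroup g K | g in [set g | forall x, ~ W x -> O (a g x)]].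
have FF : ProperFilter (filter_from (open_nbhs z) S).
  apply: filter_from_proper; last first.
    move=> O [oO Oz].
    have [|g gO] := @compress_to (~` W) O (open_closedC oW) _ oO (ex_intro _ z Oz).
      by move=> WT; have : (~` W) w by rewrite WT.
    by exists (conj_subgroup g K), g.
  apply: filter_from_filter; first by exists setT; split=> //; exact: openT.
  move=> O O' [oO Oz] [oO' Oz']; exists (O `&` O').
    by split=> //; exact: openI.
  by move=> _ [g gO <-]; split; exists g => // x /gO [].
have [K' K'F] := limit_subgroup FF; exists K'.
  apply: K'F => //; exists setT; first by split=> //; exact: openT.
  by move=> _ [g _ <-]; exact: Ainv.
move=> k /StabP /zP; rewrite nbhsE => -[O Oz Ok].
apply: (K'F _ (@closed_contains _ k)); exists O => // _ [g gO <-] /=.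
rewrite in_conj_subgroup; apply: WK; rewrite -[g]invgK.
apply: (@rist_conj _ _ _ (~` O)); last by apply/ristP => x /contrapT /Ok.
by move=> x nOx; apply: contrapT => /gO; rewrite actKV.
Qed.

Hypothesis G_countable : countable [set: G].
Hypothesis X_nonempty : [set: X] !=set0.

(** The step of the Baire category argument: either some point of [V] is moved
by [g], and so are its neighbours, or [g] is trivial on [V]. *)
Lemma shrink_generic g V : open V -> V !=set0 ->
  exists W, [/\ open W, W !=set0, closure W `<=` V &
    forall z, V z -> closure W z -> a g z = z -> nbhs z [set y | a g y = y]].
Proof.
have [Xc _ _] := boundary.
have reg O x : open O -> O x -> exists W, [/\ open W, W x & closure W `<=` O].
  move=> oO Ox; have xT : nbhs x [set: X] by exact: filterT.
  have [N xN NO] := compact_regular X_hausdorff Xc xT (open_nbhs_nbhs (conj oO Ox)).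
  move: xN; rewrite nbhsE => -[W [oW Wx] WN].
  by exists W; split=> //; apply: subset_trans NO; exact: closure_subset.
move=> oV [v Vv]; have [[x [Vx gx]]|H] := pselect (exists x, V x /\ a g x <> x).
  have [W [oW WV Wx gW]] := displaced_nbhs X_hausdorff oV Vx gx.
  have [W' [oW' W'x W'W]] := reg W x oW Wx.
  exists W'; split=> //; [by exists x|exact: subset_trans WV|].
  by move=> z _ /W'W Wz gz; have := gW z Wz; rewrite gz.
have [W [oW Wv WV]] := reg V v oV Vv; exists W; split=> //; first by exists v.
move=> z Vz _ _; have : nbhs z V by exact: open_nbhs_nbhs.
apply: filterS => y Vy; apply: contrapT => gy; apply: H.
by exists y.
Qed.

Lemma continuity_points_nonempty : Stab_continuity_points a !=set0.
Proof.
have [Xc _ _] := boundary.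
have /pcard_injP [f finj] := G_countable.
pose e n := xget 1 [set g | f g = n].
have ef g : e (f g) = g.
  rewrite /e; case: xgetP => [h _ /= hg|/(_ g) []//].
  by apply: finj => //; exact/mem_set.
pose good (p : nat * set X) W := open p.2 -> p.2 !=set0 ->
  [/\ open W, W !=set0, closure W `<=` p.2 &
    forall z, p.2 z -> closure W z -> a (e p.1) z = z ->
      nbhs z [set y | a (e p.1) y = y]].
have [s sP] : {s : nat * set X -> set X & forall p, good p (s p)}.
  apply: (@choice _ _ good) => -[n V].
  have [[oV V0]|H] := pselect (open V /\ V !=set0).
    by have [W WP] := shrink_generic (e n) oV V0; exists W.
  by exists set0 => oV V0; exfalso; apply: H.
(* Nested open sets, the n-th step taking care of the n-th element of [G]. *)
pose V := fix V n := if n is m.+1 then s (m, V m) else setT.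
have oV n : open (V n) /\ V n !=set0.
  elim: n => [|n [oV V0]]; first by split=> //; exact: openT.
  by have [] := sP (n, V n) oV V0.
have VS n := sP (n, V n) (oV n).1 (oV n).2.
have Vdec m n : (m <= n)%N -> V n `<=` V m.
  elim: n => [|n IH]; first by rewrite leqn0 => /eqP ->.
  rewrite leq_eqVlt => /orP[/eqP -> //|]; rewrite ltnS => /IH.
  by apply: subset_trans; have [_ _ + _] := VS n; apply: subset_trans; exact: subset_closure.
have FF : ProperFilter (filter_from [set: nat] V).
  apply: filter_from_proper => [|n _]; last exact: (oV n).2.
  apply: filter_fromT_filter; first by exists 0%N.
  move=> m n; exists (maxn m n) => x Vx.
  by split; apply: Vdec Vx; rewrite ?leq_maxl ?leq_maxr.
have [z zF] := compact_limit Xc FF.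
have zcl n : closure (V n) z.
  apply: zF; first exact: closed_closure.
  by exists n => //; exact: subset_closure.
exists z; apply/(continuity_pointP _ X_hausdorff) => g gz.
have [_ _ clV Vz] := VS (f g); rewrite -(ef g); apply: Vz.
- by apply: clV; exact: (zcl (f g).+1).
- exact: (zcl (f g).+1).
- by rewrite /= ef.
Qed.

(** An element of [G_z] is supported off a neighbourhood of [z]; compressing this
support into [U] conjugates it into [G_U]. *)
Lemma trivial_rist_Stab U z : open U -> U !=set0 ->
  (forall g, g \in rist a U -> g = 1) -> Stab_continuity_points a z ->
  Stab a z = trivial_subgroup G.
Proof.
move=> oU U0 rU /(continuity_pointP _ X_hausdorff) zP.
apply: eq_subgroup => g; rewrite [RHS]in_mk_subgroup /=.
apply/idP/eqP => [/StabP /zP|->]; last exact: subgroup1.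
rewrite nbhsE => -[O [oO Oz] Og].
have [|h hU] := @compress_to (~` O) U (open_closedC oO) _ oU U0.
  by move=> OT; have : (~` O) z by rewrite OT.
apply/eqP; rewrite -(conjg_eq1 g h^-1); apply/eqP/rU.
by apply: (rist_conj hU); apply/ristP => x /contrapT /Og.
Qed.

(** Approximate [K] by [G_y] with [y] generic and let [x] be a limit of the points
[y]. An element of [K] fixes [y] eventually, hence [x]; an element that is trivial
near [x] belongs to [G_y] eventually, hence to [K]. *)
Lemma stabilizer_URS_sandwich K : stabilizer_URS a K ->
  exists2 x, {subset K <= Stab a x} &
    forall g, nbhs x [set y | a g y = y] -> g \in K.
Proof.
have [Xc _ _] := boundary.
move=> clK.
pose S N := [set x | Stab_continuity_points a x /\ N (Stab a x)].
have FF : ProperFilter (filter_from (nbhs K) S).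
  apply: filter_from_proper; last first.
    by move=> N /clK [_ [[x xc <-] NK]]; exists x.
  apply: filter_from_filter; first by exists setT; exact: filterT.
  move=> N N' KN KN'; exists (N `&` N'); first exact: filterI.
  by move=> x [xc [Nx N'x]]; split; split.
have [x xF] := compact_limit Xc FF; exists x.
  move=> g gK; apply/StabP.
  suff : closed [set y | a g y = y].
    move=> /xF; apply; exists [set H | (g \in H) = (g \in K)]; first exact: near_mem.
    by move=> y [_ /= ]; rewrite gK => /StabP.
  move=> y ycl; apply: contrapT => gy.
  have [W [oW _ Wy Wg]] := displaced_nbhs X_hausdorff openT I gy.
  have [w [/= gw Ww]] := ycl W (open_nbhs_nbhs (conj oW Wy)).
  by apply: (Wg w) => //; rewrite gw.
move=> g; rewrite nbhsE => -[O [oO Ox] Og]; apply: contrapT => gK.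
have : (~` O) x; last by [].
apply: xF; first exact: open_closedC.
exists [set H | (g \in H) = (g \in K)]; first exact: near_mem.
move=> y [_ /= gy] /Og /StabP; rewrite gy => gK'; exact: gK.
Qed.

Lemma conj_Stab g x : conj_subgroup g (Stab a x) = Stab a (a g x).
Proof.
apply: eq_subgroup => k; rewrite in_conj_subgroup; apply/StabP/StabP.
  by rewrite conjgE !homeo_actM => /(congr1 (a g)); rewrite actKV.
by rewrite conjgE !homeo_actM => ->; rewrite actK.
Qed.

Lemma continuity_points_act g x :
  Stab_continuity_points a x -> Stab_continuity_points a (a g x).
Proof.
move=> /(continuity_pointP _ X_hausdorff) xP; apply/(continuity_pointP _ X_hausdorff).
move=> k kgx; have := xP (k ^ g).
rewrite conjgE !homeo_actM kgx actK => /(_ erefl) nx.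
have : nbhs (a g x) (a g^-1 @^-1` [set y | a (k ^ g) y = y]).
  by apply: homeo_act_continuous; rewrite actK.
apply: filterS => y /=; rewrite conjgE !homeo_actM actKV.
exact: act_inj.
Qed.

(** Move the point [x] of the sandwich of a given member towards a generic [z];
both bounds then converge to [G_z]. *)
Lemma URS_stabilizer : URS (stabilizer_URS a).
Proof.
have [_ amin _] := boundary.
have inv : invariant_set (stabilizer_URS a).
  move=> g K clK N /conj_subgroup_continuous /clK [_ [[x xc <-] NK]].
  exists (conj_subgroup g (Stab a x)); split=> //; rewrite conj_Stab.
  by exists (a g x) => //; exact: continuity_points_act.
have cl : closed (stabilizer_URS a) by exact: closed_closure.
split=> //.
  have [z zc] := continuity_points_nonempty; exists (Stab a z).
  by apply: subset_closure; exists z.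
move=> C [K CK] Ccl Cinv CS; apply/seteqP; split=> //.
suff CStab z : Stab_continuity_points a z -> C (Stab a z).
  rewrite (closure_id C).1//; apply: closure_subset => _ [z zc <-].
  exact: CStab.
move=> zc; have [x Kx xK] := stabilizer_URS_sandwich (CS _ CK).
pose S O := [set conj_subgroup g K | g in [set g | O (a g x)]].
have FF : ProperFilter (filter_from (open_nbhs z) S).
  apply: filter_from_proper; last first.
    move=> O [oO Oz]; have [_ [/[swap] [[g _ <-]] Ogx]] := amin x O (ex_intro _ z Oz) oO.
    by exists (conj_subgroup g K), g.
  apply: filter_from_filter; first by exists setT; split=> //; exact: openT.
  move=> O O' [oO Oz] [oO' Oz']; exists (O `&` O').
    by split=> //; exact: openI.
  by move=> _ [g [gO gO'] <-]; split; exists g.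
have [K' K'F] := limit_subgroup FF.
suff -> : Stab a z = K'.
  apply: K'F => //; exists setT; first by split=> //; exact: openT.
  by move=> _ [g _ <-]; exact: Cinv.
apply: eq_subgroup => k; apply/idP/idP.
  move=> /StabP; move/(continuity_pointP _ X_hausdorff): zc => /[apply].
  rewrite nbhsE => -[O [oO Oz] Ok].
  apply: (K'F _ (@closed_contains _ k)); exists O => // _ [g gO <-] /=.
  rewrite in_conj_subgroup; apply: xK.
  have : nbhs x (a g @^-1` O) by apply: open_nbhs_nbhs; split=> //; exact: open_act.
  by apply: filterS => y /Ok; rewrite /= conjgE !homeo_actM => ->; rewrite actK.
move=> kK'; apply/StabP; apply: contrapT => kz.
have [W [oW _ Wz Wk]] := displaced_nbhs X_hausdorff openT I kz.
have : k \notin K'; last by rewrite kK'.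
apply: (K'F _ (@closed_avoids _ k)); exists W => // _ [g Wgx <-] /=.
rewrite in_conj_subgroup; apply/negP => /Kx /StabP.
rewrite conjgE !homeo_actM => /(congr1 (a g)); rewrite actKV => kgx.
by apply: (Wk _ Wgx); rewrite kgx.
Qed.

End Boundary.

(** * Classification *)

Theorem theorem1p2 (X : topologicalType) (G : groupType)
    (a : homeo_action G X)
    (X_nonempty : [set: X] !=set0)
    (X_compact : compact [set: X])
    (X_hausdorff : hausdorff_space X)
    (G_countable : countable [set: G])
    (a_faithful : faithful_action a)
    (boundary : extreme_boundary_action a)
    (rist_basis : exists B : set (set X), basis B /\
       forall U : set X, B U -> no_finite_or_abelian_quotient (rist a U))
    (stab_maximal : forall x : X, maximal_subgroup (Stab a x))
    (A : set (subgroup_of G)) :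
  URS A <->
  [\/ A = [set trivial_subgroup G], A = [set full_subgroup G] | A = stabilizer_URS a].
Proof.
have URS1 : URS [set trivial_subgroup G].
  by apply: URS_set1 => g; exact: conj_trivial.
have URSG : URS [set full_subgroup G].
  by apply: URS_set1 => g; exact: conj_full.
have URSS : URS (stabilizer_URS a) by exact: URS_stabilizer.
split=> [URSA|[->|->|->]]//.
have A1 : A (trivial_subgroup G) -> A = [set trivial_subgroup G].
  by move=> A1; apply: URS_eq => //; exists (trivial_subgroup G).
have AG : A (full_subgroup G) -> A = [set full_subgroup G].
  by move=> AG; apply: URS_eq => //; exists (full_subgroup G).
have [z zc] :=
  continuity_points_nonempty X_hausdorff boundary G_countable X_nonempty.
have [_ maxz] := stab_maximal z.
have [A0 Acl Ainv _] := URSA.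
have [[U [oU U0 rU]]|rist_neq1] := pselect (exists U,
    [/\ open U, U !=set0 & forall g, g \in rist a U -> g = 1]).
  have Sz := trivial_rist_Stab X_hausdorff boundary oU U0 rU zc.
  have [K AK] := A0; have [|KE|KE] := maxz K.
  - by rewrite Sz => g /eqP ->; exact: subgroup1.
  - by apply: Or31; apply: A1; rewrite -Sz -KE.
  - by apply: Or32; apply: AG; rewrite -KE.
have {}rist_neq1 U : open U -> U !=set0 -> exists2 g, g \in rist a U & g != 1.
  move=> oU U0; apply: contrapT => H; apply: rist_neq1; exists U; split=> // g gU.
  by apply/eqP; apply: contrapT => /negP g1; apply: H; exists g.
have [/A1 ->|nA1] := pselect (A (trivial_subgroup G)); first exact: Or31.
have [B [Bb Bq]] := rist_basis.
have [K [W [AK oW W0 WK]]] :=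
  URS_contains_rist a_faithful X_hausdorff rist_neq1 Bb Bq A0 Acl Ainv nA1.
have [K' AK' zK'] :=
  limit_contains_Stab X_hausdorff boundary Acl Ainv AK oW W0 WK zc.
have [K'E|K'E] := maxz K' zK'; last by apply: Or32; apply: AG; rewrite -K'E.
apply: Or33; apply: URS_eq => //; exists K'; split=> //.
by rewrite K'E; apply: subset_closure; exists z.
Qed.
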